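(* Let $(X_1,Y_1),\dots,(X_n,Y_n)$ be i.i.d. with law $P$ on $\mathcal X\times\{0,1\}$, let $\Pi$ be the marginal law of $X$ under $P$, and let $\mathcal G=\{\mathbf 1_C:C\in\mathscr C\}$ for a countable collection $\mathscr C$ of measurable subsets of $\mathcal X$. Let $g_0(x)=\mathbf 1_{\eta(x)\ge1/2}$ with $\eta(x)=\mathbb E[Y|X=x]$, assume $g_0\in\mathcal G$, and assume that there is $c>0$ such that for all $g\in\mathcal G$, $$\mathcal E_P(g)\ge c\,\Pi\big(g(X)\ne g_0(X)\big).$$ Suppose there is $\alpha>0$, $\alpha\ne1$, and a constant $L>0$ such that for all $\epsilon>0$, $\log\mathcal N_I(\epsilon,\mathscr C,\Pi)\le L\epsilon^{-\alpha}$. Let $$\widehat g_n\in\arg\min_{g\in\mathcal G}\frac1n\sum_{i=1}^n\mathbf 1_{Y_i\ne g(X_i)}.$$ If $r_n^2\ge Kn^{-1/(\alpha+1)}$ for a large enough constant $K>0$, then $$\mathbb P\big(\mathcal E_P(\widehat g_n)\ge r_n^2\big)\le K'\exp(-nr_n^2/K')$$ for some constant $K'>0$. (The constants $K,K'$ do not depend on $n$ or $r_n$.)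
   Context: The excess risk is $\mathcal E_P(g)=P(Y\ne g(X))-\inf_{g'\in\mathcal G}P(Y\ne g'(X))=P(Y\neq g(X))-P(Y\neq g_0(X))$ (the Bayes classifier $g_0$ minimizes $P(Y\ne g(X))$ over all classifiers). $\mathcal N_I(\epsilon,\mathscr C,\Pi)$ is the $\epsilon$-bracketing number of $\{\mathbf 1_C:C\in\mathscr C\}$ in $L_1(\Pi)$: the minimum number of brackets $[\ell,u]=\{f:\ell\le f\le u\}$ with $\|u-\ell\|_{L_1(\Pi)}<\epsilon$ needed to cover the class; $\log$ is the ordinary natural logarithm here. $\widehat g_n$ is assumed to be well-defined. *)

(* Defs.v *)
From HB Require Import structures.
From mathcomp Require Import all_boot all_order all_algebra.
From mathcomp Require Import all_classical all_reals all_analysis.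

Set Implicit Arguments.
Unset Strict Implicit.
Unset Printing Implicit Defensive.

Import Order.TTheory GRing.Theory Num.Theory.
Import numFieldNormedType.Exports.

Local Open Scope classical_set_scope.
Local Open Scope ring_scope.

(* The label space {0,1} is bool: an observation is a pair (x, y) : T * bool,
   a classifier is a map T -> bool, and 1_C is fun x => x \in C. *)

HB.instance Definition _ d1 d2 (T1 : measurableType d1)
    (T2 : measurableType d2) :=
  isMeasurableFun.Build _ _ (T1 * T2)%type T1 fst (@measurable_fst d1 d2 T1 T2).

Section iid.
Context d d' (Omega : measurableType d) (U : measurableType d') (R : realType).
Variables (Pr : probability Omega R) (n : nat) (Z : 'I_n -> {RV Pr >-> U}).

Definition mutually_independent : Prop :=
  forall (J : {set 'I_n}) (A : 'I_n -> set U), (forall i, measurable (A i)) ->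
  (Pr (\bigcap_(i in [set` J]) (Z i @^-1` A i)) =
   \prod_(i in J) Pr (Z i @^-1` A i))%E.

Definition iid_with_law (P : probability U R) : Prop :=
  mutually_independent /\
  forall i A, measurable A -> distribution Pr (Z i) A = P A.

End iid.

Section bracketing.
Context d (T : measurableType d) (R : realType).
Variable mu : {measure set T -> \bar R}.

Definition bracket_cover (F : set (T -> R)) (eps : R) (N : nat) : Prop :=
  exists l u : 'I_N -> T -> R,
    (forall i, [/\ measurable_fun setT (l i), measurable_fun setT (u i) &
       ('N[mu]_1[EFin \o (u i \- l i)%R] < eps%:E)%E]) /\
    (forall f, F f -> exists i, forall x, l i x <= f x <= u i x).

(* +oo when no finite family of brackets covers F. *)
Definition bracketing_number (F : set (T -> R)) (eps : R) : \bar R :=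
  ereal_inf [set (N%:R)%:E | N in bracket_cover F eps].

End bracketing.

Section classification.
Context d (T : measurableType d) (R : realType).
Variable P : probability (T * bool)%type R.

Definition marginal : probability T R := distribution P fst.

Definition classifiers (C : set (set T)) : set (T -> bool) :=
  [set (fun x => x \in A) | A in C].

Definition indicators (C : set (set T)) : set (T -> R) :=
  [set (\1_A : T -> R) | A in C].

(* eta is a version of x |-> E[Y | X = x]; versions are unique only up to
   a null set of the marginal. *)
Definition is_regression_function (eta : T -> R) : Prop :=
  marginal.-integrable setT (EFin \o eta) /\
  forall B : set T, measurable B ->
    (\int[marginal]_(x in B) (eta x)%:E =
     \int[P]_(z in fst @^-1` B) ((z.2 : nat)%:R)%:E)%E.

Definition bayes_classifier (eta : T -> R) : T -> bool :=
  fun x => 2^-1 <= eta x.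

Definition risk (g : T -> bool) : R :=
  fine (P [set z : T * bool | z.2 != g z.1]).

Definition excess_risk (G : set (T -> bool)) (g : T -> bool) : R :=
  risk g - inf [set risk g' | g' in G].

Definition disagreement (g g' : T -> bool) : R :=
  fine (marginal [set x | g x != g' x]).

End classification.

Definition empirical_risk (R : realType) (T : Type) (n : nat)
    (z : 'I_n -> T * bool) (g : T -> bool) : R :=
  n%:R^-1 * \sum_(i < n) ((z i).2 != g (z i).1)%:R.

Definition argmins (R : realType) (U : Type) (G : set U) (F : U -> R) : set U :=
  [set g | G g /\ forall g', G g' -> F g <= F g'].

(* Main.v *)
(** One bracketing at scale delta = r^2 / 2 in L1 suffices; no chaining is
    needed. If lo <= A <= up is a bracket of width delta around a classifier of
    excess risk at least r^2, the lower bracket B of its misclassification set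
    has P B - P B' >= delta, with B' the misclassification set of the Bayes
    classifier, while the margin condition bounds the variance of 1_B - 1_B' by
    (1 + 2/c) (P B - P B'). If the empirical risk minimiser lies in this
    bracket, B is hit by the sample no more often than B', which by Bernstein's
    argument has probability at most exp (- n delta / (8 (1 + 2/c))). The union
    bound costs the factor exp (L delta^-alpha), which is absorbed exactly when
    delta^(alpha + 1) is a large multiple of 1/n. *)

Require Import Defs.
From mathcomp Require Import all_boot all_order all_algebra.
From mathcomp Require Import all_classical all_reals all_analysis.
From mathcomp Require Import measurable_realfun ring lra.

Set Implicit Arguments.
Unset Strict Implicit.
Unset Printing Implicit Defensive.

Import Order.TTheory GRing.Theory Num.Theory.
Import numFieldNormedType.Exports.

Local Open Scope classical_set_scope.
Local Open Scope ring_scope.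

(** * Real-valued probabilities and a finite union bound *)

Section fine_probability.
Context (d : measure_display) (T : measurableType d) (R : realType).
Variable P : probability T R.

Lemma fine_probability_ge0 (A : set T) : 0 <= fine (P A).
Proof. exact: fine_ge0. Qed.

Lemma fine_probability_le1 (A : set T) : measurable A -> fine (P A) <= 1.
Proof.
by move=> mA; rewrite -lee_fin fineK ?fin_num_measure// probability_le1.
Qed.

Lemma fine_probability_sub2 (A B B' : set T) :
  measurable A -> measurable B -> measurable B' -> A `<=` B `|` B' ->
  fine (P A) <= fine (P B) + fine (P B').
Proof.
move=> mA mB mB' AB; rewrite -lee_fin EFinD !fineK ?fin_num_measure//.
apply: le_trans (measureU2 _ mB mB').
by apply: le_measure; rewrite ?inE//; exact: measurableU.
Qed.

Lemma fine_probability_sub (A B : set T) :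
  measurable A -> measurable B -> A `<=` B -> fine (P A) <= fine (P B).
Proof.
by move=> mA mB AB; rewrite -lee_fin !fineK ?fin_num_measure// le_measure ?inE.
Qed.

Lemma fine_probabilityDI (A B : set T) : measurable A -> measurable B ->
  fine (P A) = fine (P (A `\` B)) + fine (P (A `&` B)).
Proof.
move=> mA mB; have mD := measurableD mA mB; have mI := measurableI _ _ mA mB.
by rewrite (measureDI P mA mB) fineD// fin_num_measure.
Qed.

End fine_probability.

Lemma finite_union_bound (d : measure_display) (T : measurableType d)
    (R : realType) (mu : {measure set T -> \bar R}) (I : finType) (p : pred I)
    (F : I -> set T) :
  (forall i, p i -> measurable (F i)) ->
  measurable (\big[setU/set0]_(i | p i) F i) /\
  (mu (\big[setU/set0]_(i | p i) F i) <= \sum_(i | p i) mu (F i))%E.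
Proof.
move=> mF; elim/big_rec2: _ => [|i m A pi [mA le_mu]].
  by rewrite measure0; split; [exact: measurable0 | exact: lexx].
split; first by apply: measurableU => //; exact: mF.
apply: (le_trans (measureU2 _ (mF i pi) mA)).
by rewrite leeD2l.
Qed.

(** * Exponential tail bounds for i.i.d. counts *)

Section chernoff.
Context (R : realType) (d d' : measure_display) (Omega : measurableType d).
Context (U : measurableType d') (P : probability U R) (Pr : probability Omega R).
Context (n : nat) (Z : 'I_n -> {RV Pr >-> U}).
Hypothesis iidZ : iid_with_law Z P.

Lemma iid_bigcap (A : 'I_n -> set U) : (forall i, measurable (A i)) ->
  Pr (\bigcap_i (Z i @^-1` A i)) = (\prod_i fine (P (A i)))%:E.
Proof.
move=> mA; have [indep law] := iidZ.
have /= := indep [set: 'I_n]%SET A mA.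
rewrite (_ : [set` [set: 'I_n]%SET] = setT); last first.
  by apply/seteqP; split=> i //= _; rewrite inE.
move=> ->; rewrite (eq_bigr (fun i => (fine (P (A i)))%:E)).
  by rewrite prodEFin; congr EFin; apply: eq_bigl => i; rewrite inE.
by move=> i _; rewrite fineK ?fin_num_measure// -(law i).
Qed.

(* A statistic with finitely many values turns the law of the sample into a
   finite product law, so the Laplace transform is a finite sum. *)
Lemma chernoff_finite (S : finType) (q : U -> S) (v : S -> R) :
  (forall s, measurable (q @^-1` [set s])) ->
  let E := [set w | \sum_i v (q (Z i w)) <= 0] in
  measurable E /\
  (Pr E <= ((\sum_s fine (P (q @^-1` [set s])) * expR (- v s)) ^+ n)%:E)%E.
Proof.
move=> mq E.
pose p s := fine (P (q @^-1` [set s])).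
pose F (f : {ffun 'I_n -> S}) := \bigcap_i (Z i @^-1` (q @^-1` [set f i])).
pose neg (f : {ffun 'I_n -> S}) := \sum_i v (f i) <= 0.
have mF f : measurable (F f).
  by apply: fin_bigcap_measurable => // i _; exact: measurable_funPTI.
(* The vector [f] of observed values decides the event, so [E] is a finite union of product cells
   [F f]. *)
have EF : E = \big[setU/set0]_(f | neg f) F f.
  rewrite -(bigcup_pred neg F); apply/seteqP; split=> w.
    move=> Ew; exists [ffun i => q (Z i w)]; last by move=> i _ /=; rewrite ffunE.
    rewrite /= unfold_in /neg.
    by under eq_bigr do rewrite ffunE.
  move=> [f negf Ff]; rewrite /E /=.
  by under eq_bigr => i _ do rewrite (Ff i I).
rewrite EF; have [mU le_mu] := @finite_union_bound _ _ _ Pr _ neg F (fun f _ => mF f).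
split=> //; apply: (le_trans le_mu).
rewrite (eq_bigr (fun f : {ffun 'I_n -> S} => (\prod_i p (f i))%:E)); last first.
  by move=> f _; exact: (@iid_bigcap (fun i => q @^-1` [set f i])).
have p_ge0 s : 0 <= p s by rewrite fine_ge0.
rewrite sumEFin lee_fin.
have -> : (\sum_s p s * expR (- v s)) ^+ n =
    \sum_(f : {ffun 'I_n -> S}) \prod_i (p (f i) * expR (- v (f i))).
  rewrite -(bigA_distr_bigA (fun (i : 'I_n) s => p s * expR (- v s))).
  by rewrite prodr_const card_ord.
rewrite big_mkcond /=; apply: ler_sum => f _.
have prod_ge0 : 0 <= \prod_i p (f i) by rewrite prodr_ge0.
rewrite big_split /= -expR_sum sumrN.
case: ifPn => [negf|_]; last by rewrite mulr_ge0 ?expR_ge0.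
(* Markov's step: when the sum of the values is at most 0, the exponential weight is at least 1. *)
rewrite -[leLHS]mulr1 ler_wpM2l// (le_trans _ (expR_ge1Dx _))//.
by rewrite lerDl oppr_ge0.
Qed.

(** Chernoff's bound for the statistic [lam] times 1_B - 1_A. It depends only on the four cells cut
    out by [A] and [B], and it vanishes outside the two differences. *)
Lemma chernoff_count (A B : set U) (lam : R) :
  measurable A -> measurable B -> 0 < lam ->
  let E := [set w | \sum_i ((Z i w \in B)%:R : R) <=
                    \sum_i ((Z i w \in A)%:R : R)] in
  measurable E /\
  (Pr E <= ((1 + fine (P (B `\` A)) * (expR (- lam) - 1)
               + fine (P (A `\` B)) * (expR lam - 1)) ^+ n)%:E)%E.
Proof.
move=> mA mB lam0 E.
pose q (u : U) := (u \in A, u \in B).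
pose v (s : bool * bool) : R := lam * (s.2%:R - s.1%:R).
pose side (X : set U) (b : bool) := if b then X else ~` X.
have qE s : q @^-1` [set s] = side A s.1 `&` side B s.2.
  have inside X u b : (u \in X) = b <-> side X b u.
    case: b; rewrite /side; split=> [h|h].
    - exact: set_mem.
    - exact: mem_set.
    - by move=> Xu; rewrite mem_set in h.
    - exact: memNset.
  apply/seteqP; case: s => a b; split=> u /=.
    by case=> /inside ? /inside.
  by move=> [/inside + /inside]; rewrite /q => -> ->.
have mside X b : measurable X -> measurable (side X b).
  by case: b => // mX; exact: measurableC.
have mq s : measurable (q @^-1` [set s]).
  by rewrite qE; apply: measurableI; exact: mside.
have -> : E = [set w | \sum_i v (q (Z i w)) <= 0].
  apply/seteqP; split=> w; rewrite /E /= /v -mulr_sumr pmulr_rle0// sumrB subr_le0//.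
have [mE /le_trans PrE] := @chernoff_finite _ q v mq.
split=> //; apply: PrE; rewrite lee_fin le_eqVlt; apply/orP; left; apply/eqP.
congr (_ ^+ n).
pose G a b := fine (P (q @^-1` [set (a, b)])) * expR (- v (a, b)).
rewrite (eq_bigr (fun s => G s.1 s.2)); last by case.
rewrite -(pair_bigA _ G) /= !big_bool /= /G !qE /= /v /=.
rewrite subrr mulr0 subr0 mulr1 sub0r mulrN1 opprK subrr mulr0 oppr0 expR0.
rewrite -!setDE !mulr1 [~` A `&` B]setIC -setDE.
have one : fine (P (A `&` B)) + fine (P (A `\` B)) + fine (P (B `\` A))
    + fine (P (~` A `\` B)) = 1.
  have := fine_probabilityDI P measurableT mA.
  rewrite probability_setT setTI setTD /=.
  rewrite (fine_probabilityDI P mA mB) (fine_probabilityDI P (measurableC mA) mB).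
  rewrite [~` A `&` B]setIC -setDE; lra.
have -> : fine (P (~` A `\` B)) = 1 - fine (P (A `&` B)) -
    fine (P (A `\` B)) - fine (P (B `\` A)) by lra.
by ring.
Qed.

(** The probability of the symmetric difference is the second moment of 1_B - 1_A. Bounding it by
    [k] times the mean [m] makes the exponent linear in [m] instead of quadratic. *)
Lemma chernoff_bernstein (A B : set U) (k : R) :
  measurable A -> measurable B -> 1 <= k ->
  let m := fine (P B) - fine (P A) in
  fine (P (B `\` A)) + fine (P (A `\` B)) <= k * m ->
  let E := [set w | \sum_i ((Z i w \in B)%:R : R) <=
                    \sum_i ((Z i w \in A)%:R : R)] in
  measurable E /\ (Pr E <= (expR (- (n%:R * (m / (8 * k)))))%:E)%E.
Proof.
move=> mA mB k1 m var_le E.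
(* With this choice the quadratic cost [2 * lam ^+ 2 * (k * m)] is half of the linear gain
   [lam * m]. *)
pose lam := (4 * k)^-1.
have k0 : 0 < k by lra.
have lam0 : 0 < lam by rewrite invr_gt0; lra.
have lamk : lam * k = 4^-1 by rewrite /lam; field; lra.
have lam_le : lam <= 4^-1 by nra.
have [mE /le_trans PrE] := chernoff_count mA mB lam0.
split=> //; apply: PrE; rewrite lee_fin -mulrN expRM_natl.
set a := fine (P (B `\` A)) in var_le *; set b := fine (P (A `\` B)) in var_le *.
have mE' : m = a - b.
  rewrite /m (fine_probabilityDI P mA mB) (fine_probabilityDI P mB mA) setIC.
  by rewrite -/a -/b; ring.
have a0 : 0 <= a by exact: fine_probability_ge0.
have b0 : 0 <= b by exact: fine_probability_ge0.
have a1 : a <= 1 by apply: fine_probability_le1; exact: measurableD.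
(* The tangent bound at -lam, inverted through [elamV], gives e^lam <= 1/(1 - lam) <= 1 + lam + 2
   lam^2, as lam <= 1/4; the bound on e^(-lam) is symmetric. *)
have elam1 := expR_ge1Dx lam.
have emlam1 := expR_ge1Dx (- lam).
have elamV : expR lam * expR (- lam) = 1 by rewrite expRN mulfV// gt_eqF ?expR_gt0.
have emlam : expR (- lam) - 1 <= - lam + 2 * lam ^+ 2 by nra.
have elam : expR lam - 1 <= lam + 2 * lam ^+ 2 by nra.
have lin : 1 + a * (expR (- lam) - 1) + b * (expR lam - 1) <= 1 - lam * m / 2.
  have : lam * (lam * (a + b)) <= lam * (m / 4).
    by rewrite ler_wpM2l ?(ltW lam0)//; nra.
  by nra.
apply: lerXn2r.
- by rewrite nnegrE; nra.
- by rewrite nnegrE expR_ge0.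
apply: (le_trans lin); apply: le_trans (expR_ge1Dx _).
by rewrite le_eqVlt; apply/orP; left; apply/eqP; rewrite /lam; field; lra.
Qed.

End chernoff.

(** * Set brackets, bracketing entropy and the rate *)

Section bracketing_sets.
Context (d : measure_display) (T : measurableType d) (R : realType).

(* A bracket l <= 1_A <= u may be replaced by the set bracket
   {l > 0} `<=` A `<=` {u >= 1}, and |u - l| >= 1 on the gap. *)
Lemma bracket_cover_sets (mu : probability T R) (C : set (set T)) (eps : R)
    (N : nat) :
  bracket_cover mu (indicators C) eps N ->
  exists lo up : 'I_N -> set T,
    (forall i, [/\ measurable (lo i), measurable (up i) &
                   fine (mu (up i `\` lo i)) <= eps]) /\
    (forall A, C A -> exists i, lo i `<=` A /\ A `<=` up i).
Proof.
move=> [l [u [lu cover]]].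
pose lo i := [set x | 0 < l i x]; pose up i := [set x | 1 <= u i x].
exists lo, up; split=> [i|A CA].
  have [ml mu' norm_lt] := lu i.
  have mlo : measurable (lo i).
    rewrite /lo (_ : [set _ | _] = l i @^-1` `]0, +oo[%classic).
      by rewrite -[X in measurable X]setTI; exact: ml.
    by apply/seteqP; split=> x /=; rewrite in_itv/= andbT.
  have mup : measurable (up i).
    rewrite /up (_ : [set _ | _] = u i @^-1` `[1, +oo[%classic).
      by rewrite -[X in measurable X]setTI; exact: mu'.
    by apply/seteqP; split=> x /=; rewrite in_itv/= andbT.
  split=> //; have mgap := measurableD mup mlo.
  rewrite -lee_fin fineK ?fin_num_measure//; apply: le_trans (ltW norm_lt).
  have /measurable_EFinP mdiff := measurable_funB mu' ml.
  (* Markov's inequality for |u - l| at threshold 1. *)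
  rewrite Lnorm1; apply: le_trans (le_integral_abse mu measurableT mdiff ltr01).
  rewrite mul1e; apply: le_measure; rewrite ?inE//.
    apply: emeasurable_fun_c_infty => //; exact: measurableT_comp.
  move=> x [/= ux /negP]; rewrite -leNgt => lx; split=> //=.
  rewrite lee_fin; apply: le_trans (ler_norm _).
  by rewrite /up /= in ux; rewrite /=; lra.
have [i lAu] := cover \1_A (ex_intro2 _ _ A CA erefl).
exists i; split=> x /=.
  move=> lx; apply: contrapT => nA; have /andP[+ _] := lAu x.
  by rewrite indicE memNset// leNgt lx.
move=> Ax; have /andP[_] := lAu x.
by rewrite indicE mem_set.
Qed.

(** The bracketing number is an infimum; the factor 2 makes the bound strict, so that an actual
    cover lies below it. *)
Lemma bracketing_number_lt (mu : probability T R) (F : set (T -> R))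
    (eps b : R) :
  (lne (bracketing_number mu F eps) <= b%:E)%E ->
  exists2 N : nat, bracket_cover mu F eps N & N%:R <= 2 * expR b.
Proof.
move=> le_b.
have : (bracketing_number mu F eps < (2 * expR b)%:E)%E.
  have e0 := expR_gt0 b.
  case: (bracketing_number _ _ _) le_b => [x| |] //; last by rewrite ltNyr.
  have [x0 _|x0] := leP x 0; first by rewrite lte_fin; lra.
  rewrite lne_EFin// lee_fin -ler_expR lnK ?posrE// lte_fin => ?; lra.
by case/ereal_inf_lt => _ [N cov <-]; rewrite lte_fin => /ltW; exists N.
Qed.

End bracketing_sets.
(** Raising the hypothesis to the power [alpha + 1] gives D / x <= e^(alpha + 1). With [x] the
    sample size and [e] the bracket width, this is where the entropy is balanced against the
    exponent. *)
Lemma powR_rate (R : realType) (D x e alpha : R) :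
  0 < D -> 0 < x -> 0 < alpha ->
  D `^ (alpha + 1)^-1 * x `^ (- (alpha + 1)^-1) <= e ->
  D * e `^ (- alpha) <= x * e.
Proof.
move=> D0 x0 al0 le_e.
have al1 : alpha + 1 != 0 by rewrite gt_eqF// addr_gt0.
have e0 : 0 < e by apply: lt_le_trans le_e; rewrite mulr_gt0 ?powR_gt0.
have : D / x <= e * e `^ alpha.
  have -> : D / x = (D `^ (alpha + 1)^-1 * x `^ (- (alpha + 1)^-1)) `^ (alpha + 1).
    rewrite powRM ?powR_ge0// -!powRrM mulNr mulVf// powRN.
    by rewrite !powRr1 ?(ltW D0) ?(ltW x0).
  have -> : e * e `^ alpha = e `^ (alpha + 1).
    by rewrite powRD ?(gt_eqF e0) ?implybT// powRr1 ?(ltW e0)// mulrC.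
  apply: ge0_ler_powR => //.
  - by rewrite addr_ge0// ltW.
  - by rewrite nnegrE mulr_ge0 ?powR_ge0.
  - by rewrite nnegrE ltW.
rewrite ler_pdivrMr// powRN => le_De.
by rewrite ler_pdivrMr ?powR_gt0// (le_trans le_De)// mulrC mulrA.
Qed.

(** * Misclassification sets and the margin condition *)

Section loss.
Context (d : measure_display) (T : measurableType d) (R : realType).
Variable P : probability (T * bool)%type R.

(* For lo `<=` A `<=` up, this is a lower bracket of the misclassification set
   [loss_set A A] of the classifier 1_A. *)
Definition loss_set (lo up : set T) : set (T * bool) :=
  [set z | if z.2 then ~ up z.1 else lo z.1].

Lemma measurable_loss_set (lo up : set T) :
  measurable lo -> measurable up -> measurable (loss_set lo up).
Proof.
move=> mlo mup.
have -> : loss_set lo up = (~` up `*` [set true]) `|` (lo `*` [set false]).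
  apply/seteqP; split=> -[x []]; rewrite /loss_set /=.
  - by left.
  - by right.
  - by case=> -[].
  - by case=> -[].
by apply: measurableU; apply: measurableX => //; exact: measurableC.
Qed.

Lemma loss_set_sub (lo A up : set T) :
  lo `<=` A -> A `<=` up -> loss_set lo up `<=` loss_set A A.
Proof.
by move=> loA Aup [x []]; rewrite /loss_set /=; [move=> + /Aup|move=> /loA].
Qed.

Lemma loss_setE (A : set T) (z : T * bool) :
  (z \in loss_set A A) = (z.2 != (z.1 \in A)).
Proof.
case: z => x y /=; apply/idP/idP => [/set_mem|neq].
  rewrite /loss_set /=; case: y => Ax; first by rewrite memNset.
  by rewrite mem_set.
apply/mem_set; rewrite /loss_set /=; have [Ax|nAx] := pselect (A x).
  by move: neq; rewrite mem_set//; case: y.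
by move: neq; rewrite memNset//; case: y.
Qed.

Lemma riskE (A : set T) : risk P (fun x => x \in A) = fine (P (loss_set A A)).
Proof.
rewrite /risk; congr (fine (P _)); apply/seteqP; split=> z /=.
  by rewrite -loss_setE => /set_mem.
by move=> /mem_set; rewrite loss_setE.
Qed.

Lemma measurable_fst_preimage (B : set T) : measurable B ->
  measurable (fst @^-1` B : set (T * bool)).
Proof.
by move=> mB; rewrite -[X in measurable X]setTI; exact: measurable_fst.
Qed.

Lemma measurable_neq (A A' : set T) : measurable A -> measurable A' ->
  measurable [set x | (x \in A) != (x \in A')].
Proof.
move=> mA mA'; rewrite (_ : [set _ | _] = (A `\` A') `|` (A' `\` A)).
  by apply: measurableU; exact: measurableD.
apply/seteqP; split=> x /=.
  have [Ax|nAx] := pselect (A x); have [A'x|nA'x] := pselect (A' x).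
  - by rewrite !mem_set.
  - by left.
  - by right.
  - by rewrite !memNset.
by case=> -[Ax A'x]; rewrite (mem_set Ax) (memNset A'x).
Qed.

Lemma loss_set_neq (A A' : set T) (z : T * bool) :
  loss_set A A z -> ~ loss_set A' A' z -> (z.1 \in A) != (z.1 \in A').
Proof.
move=> /mem_set + nA'; rewrite loss_setE => neq; apply/eqP => eqA.
by apply: nA'; apply: set_mem; rewrite loss_setE -eqA.
Qed.

Lemma risk_le_disagreement (A A' : set T) : measurable A -> measurable A' ->
  risk P (fun x => x \in A') <=
  risk P (fun x => x \in A) + disagreement P (fun x => x \in A) (fun x => x \in A').
Proof.
move=> mA mA'; rewrite !riskE.
have mD := measurable_fst_preimage (measurable_neq mA mA').
apply: (fine_probability_sub2 _ _ _ mD); try exact: measurable_loss_set.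
move=> z lA'; have [lA|nA] := pselect (loss_set A A z); first by left.
by right; rewrite /= eq_sym; exact: loss_set_neq lA' nA.
Qed.

(* A uniform margin forces g' to be a risk minimiser of G: every g in G has
   risk g >= (c * risk g' + inf) / (c + 1). *)
Lemma margin_inf_risk (C : set (set T)) (A' : set T) (c : R) :
  (forall A, C A -> measurable A) -> C A' -> 0 < c ->
  (forall g, classifiers C g ->
    c * disagreement P g (fun x => x \in A') <= excess_risk P (classifiers C) g) ->
  inf [set risk P g | g in classifiers C] = risk P (fun x => x \in A').
Proof.
move=> mC CA' c0 margin.
set I := inf _; set r' := risk P _.
have GA' : classifiers C (fun x => x \in A') by exists A'.
apply/eqP; rewrite eq_le; apply/andP; split.
  apply: ge_inf; last by exists (fun x => x \in A').
  by exists 0 => _ [g _ <-]; exact: fine_probability_ge0.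
have : (c * r' + I) / (c + 1) <= I.
  apply: lb_le_inf; first by exists r', (fun x => x \in A').
  move=> _ [_ [A CA <-] <-].
  have /margin : classifiers C (fun x => x \in A) by exists A.
  have := risk_le_disagreement (mC _ CA) (mC _ CA').
  rewrite /excess_risk -/I -/r' ler_pdivrMr; last by lra.
  by nra.
rewrite ler_pdivrMr; last by lra.
by move=> le_I; rewrite -(ler_pM2l c0); lra.
Qed.

(** Passing from [A] to its lower bracket costs at most [delta], hence m >= excess - delta >= delta
    and excess <= 2 m. The symmetric difference of [B] and [B'] has probability at most that of the
    disagreement, which is at most 2 m / c by the margin, plus [delta <= m]. *)
Lemma bracket_margin (lo A up A' : set T) (c delta : R) :
  measurable lo -> measurable A -> measurable up -> measurable A' ->
  lo `<=` A -> A `<=` up -> 0 < c ->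
  fine (marginal P (up `\` lo)) <= delta ->
  let excess := risk P (fun x => x \in A) - risk P (fun x => x \in A') in
  c * disagreement P (fun x => x \in A) (fun x => x \in A') <= excess ->
  2 * delta <= excess ->
  let B := loss_set lo up in let B' := loss_set A' A' in
  let m := fine (P B) - fine (P B') in
  delta <= m /\
  fine (P (B `\` B')) + fine (P (B' `\` B)) <= (1 + 2 / c) * m.
Proof.
move=> mlo mA mup mA' loA Aup c0 gap_le excess margin le_excess B B' m.
pose gap : set (T * bool) := fst @^-1` (up `\` lo).
pose D : set (T * bool) := fst @^-1` [set x | (x \in A) != (x \in A')].
pose BA := loss_set A A.
have mgap : measurable gap by exact: measurable_fst_preimage (measurableD mup mlo).
have mD : measurable D by exact: measurable_fst_preimage (measurable_neq mA mA').
have mB : measurable B by exact: measurable_loss_set.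
have mB' : measurable B' by exact: measurable_loss_set.
have mBA : measurable BA by exact: measurable_loss_set.
have BBA : B `<=` BA := loss_set_sub loA Aup.
have BABgap : BA `<=` B `|` gap.
  move=> [x []]; rewrite /B /BA /gap /loss_set /= => Ax.
    have [ux|] := pselect (up x); last by left.
    by right; split=> // /loA.
  have [lx|] := pselect (lo x); first by left.
  by right; split=> //; exact: Aup.
(* The marginal is the image of [P] under [fst], so this is a conversion. *)
have {}gap_le : fine (P gap) <= delta by [].
have risk_gap : fine (P BA) <= fine (P B) + fine (P gap).
  exact: fine_probability_sub2.
have gain : fine (P (B `\` B')) <= fine (P (D `\` B')).
  apply: fine_probability_sub; try exact: measurableD.
  by move=> z [/BBA Bz nB'z]; split=> //; exact: loss_set_neq Bz nB'z.
(* A point of [B'] outside [B] either is misclassified by [A], hence in the gap, or separates [A]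
   from [A']. *)
have lose : fine (P (B' `\` B)) <= fine (P (D `&` B')) + fine (P gap).
  apply: fine_probability_sub2 => //; [exact: measurableD|exact: measurableI|].
  move=> z [B'z nBz]; have [/BABgap[]//|nBAz] := pselect (BA z); first by right.
  by left; split=> //; rewrite /D /= eq_sym; exact: loss_set_neq B'z nBAz.
have disagreeE := fine_probabilityDI P mD mB'.
rewrite -[disagreement _ _ _]/(fine (P D)) in margin.
have excessE : excess = fine (P BA) - fine (P B') by rewrite /excess !riskE.
have m_ge : excess - delta <= m by rewrite excessE /m; lra.
split; first by lra.
have disagree_le : fine (P D) <= 2 * m / c.
  by rewrite ler_pdivlMr// mulrC; lra.
by rewrite mulrDl mul1r [2 / c * m]mulrAC; lra.
Qed.

End loss.

(** * Union bound over the brackets *)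

Theorem theorem3p5 (R : realType) (d : measure_display) (T : measurableType d)
    (P : probability (T * bool)%type R) (C : set (set T)) (eta : T -> R)
    (c alpha L : R)
    (countableC : countable C)
    (measurableC : forall A, C A -> measurable A)
    (eta_regression : is_regression_function P eta)
    (bayes_in_class : classifiers C (bayes_classifier eta))
    (c_gt0 : 0 < c)
    (margin : forall g, classifiers C g ->
      c * disagreement P g (bayes_classifier eta)
        <= excess_risk P (classifiers C) g)
    (alpha_gt0 : 0 < alpha) (alpha_neq1 : alpha != 1) (L_gt0 : 0 < L)
    (entropy : forall eps : R, 0 < eps ->
      (lne (bracketing_number (marginal P) (indicators C) eps)
        <= (L * eps `^ (- alpha))%:E)%E) :
  exists K K' : R, [/\ 0 < K, 0 < K' &
    forall (n : nat) (d' : measure_display) (Omega : measurableType d')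
      (Pr : probability Omega R) (Z : 'I_n -> {RV Pr >-> (T * bool)%type})
      (ghat : Omega -> T -> bool) (r : R),
    (0 < n)%N ->
    iid_with_law Z P ->
    (forall w, argmins (classifiers C)
                 (empirical_risk R (fun i => Z i w)) (ghat w)) ->
    measurable [set w | r ^+ 2 <= excess_risk P (classifiers C) (ghat w)] ->
    K * n%:R `^ (- (alpha + 1)^-1) <= r ^+ 2 ->
    (Pr [set w | (r ^+ 2 <= excess_risk P (classifiers C) (ghat w))%R]
      <= (K' * expR (- (n%:R * r ^+ 2 / K')))%:E)%E].
Proof.
case: bayes_in_class => A' CA' bayesE; rewrite -bayesE in margin.
have inf_risk := margin_inf_risk measurableC CA' c_gt0 margin.
have mA' := measurableC _ CA'.
pose k := 1 + 2 / c; have k1 : 1 <= k by rewrite lerDl divr_ge0// ltW.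
have k0 : 0 < k by lra.
(* This [D] lets the entropy use at most half of the exponent [n%:R * delta / (8 * k)]. As delta =
   r^2 / 2, the remaining half is n r^2 / (32 k), whence [K']; the same halving doubles [K]. *)
pose D := 16 * k * L; have D0 : 0 < D by rewrite !mulr_gt0.
exists (2 * D `^ (alpha + 1)^-1), (32 * k); split.
- by rewrite mulr_gt0 ?powR_gt0.
- by rewrite mulr_gt0.
move=> n d' Omega Pr Z ghat r n0 iidZ ghat_argmin mbad r_ge.
pose delta := r ^+ 2 / 2.
have n0R : 0 < n%:R :> R by rewrite ltr0n.
have rate : D `^ (alpha + 1)^-1 * n%:R `^ (- (alpha + 1)^-1) <= delta.
  by rewrite /delta; lra.
have delta0 : 0 < delta.
  by apply: lt_le_trans rate; rewrite mulr_gt0 ?powR_gt0.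
have entropy_le : L * delta `^ (- alpha) <= n%:R * delta / (16 * k).
  rewrite ler_pdivlMr; last by rewrite mulr_gt0.
  by rewrite mulrC mulrA; exact: powR_rate rate.
have [N /bracket_cover_sets[lo [up [lo_up cover]]] N_le] :=
  bracketing_number_lt (entropy _ delta0).
pose B i := loss_set (lo i) (up i); pose B' := loss_set A' A'.
(* Only brackets holding a classifier of large excess risk matter: that witness supplies the margin
   bound, while [E i] depends on the bracket alone. *)
pose bad (i : 'I_N) := `[< exists A, [/\ C A, lo i `<=` A, A `<=` up i &
  r ^+ 2 <= excess_risk P (classifiers C) (fun x => x \in A)] >].
pose E i := [set w | \sum_j ((Z j w \in B i)%:R : R) <=
                     \sum_j ((Z j w \in B')%:R : R)].
have tail i : bad i ->
    measurable (E i) /\ (Pr (E i) <= (expR (- (n%:R * delta / (8 * k))))%:E)%E.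
  move=> /asboolP[A [CA loA Aup r_le]].
  have [mlo mup gap_le] := lo_up i.
  have /margin : classifiers C (fun x => x \in A) by exists A.
  rewrite /excess_risk inf_risk => marginA.
  rewrite /excess_risk inf_risk in r_le.
  have [|m_ge var_le] := bracket_margin mlo (measurableC _ CA) mup mA' loA Aup
    c_gt0 gap_le marginA; first by rewrite /delta; lra.
  have mB : measurable (B i) by exact: measurable_loss_set.
  have mB' : measurable B' by exact: measurable_loss_set.
  have [mE PrE] := chernoff_bernstein iidZ mB' mB k1 var_le.
  split=> //; apply: le_trans PrE _.
  rewrite lee_fin ler_expR lerN2 -mulrA ler_wpM2l ?(ltW n0R)//.
  by rewrite ler_wpM2r// invr_ge0 mulr_ge0 ?(ltW k0).
have [mU PrU] := finite_union_bound Pr (fun i bi => (tail i bi).1).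
have bad_sub : [set w | r ^+ 2 <= excess_risk P (classifiers C) (ghat w)] `<=`
    \big[setU/set0]_(i | bad i) E i.
  move=> w /= r_le; rewrite -(bigcup_pred bad E).
  have [[A CA gA] /(_ (fun x => x \in A')) emp] := ghat_argmin w.
  have [i [loA Aup]] := cover _ CA.
  exists i; first by apply/asboolP; exists A; rewrite gA.
  have : empirical_risk R (fun i => Z i w) (ghat w) <=
      empirical_risk R (fun i => Z i w) (fun x => x \in A').
    by apply: emp; exists A'.
  rewrite -gA /empirical_risk ler_pM2l ?invr_gt0//.
  under eq_bigr do rewrite -loss_setE.
  under [X in _ <= X -> _]eq_bigr do rewrite -loss_setE.
  (* The lower bracket is hit no more often than [ghat w] errs, and [ghat w] errs no more often than
     the Bayes classifier. *)
  rewrite /E /=; apply: le_trans; apply: ler_sum => j _.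
  case: (boolP (_ \in B i)) => // /set_mem /(loss_set_sub loA Aup).
  by move=> /mem_set ->.
apply: (le_trans (le_measure Pr _ _ bad_sub)); rewrite ?inE//.
apply: (le_trans PrU).
pose q := expR (- (n%:R * delta / (8 * k))).
apply: (@le_trans _ _ (\sum_(i < N) q%:E)%E).
  rewrite big_mkcond /=; apply: lee_sum => i _.
  by case: ifPn => [/tail[]//|_]; rewrite lee_fin expR_ge0.
rewrite sumEFin lee_fin sumr_const card_ord -[q *+ N]mulr_natl.
have q_ge0 : 0 <= q by exact: expR_ge0.
apply: (le_trans (ler_wpM2r q_ge0 N_le)).
(* The prefactor 2 from the cover size is below [32 * k]; the exponents are compared through
   [entropy_le]. *)
rewrite /q -[leLHS]mulrA -expRD; apply: ler_pM; rewrite ?expR_ge0//; first by lra.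
rewrite ler_expR.
have -> : n%:R * r ^+ 2 / (32 * k) = n%:R * delta / (16 * k).
  by rewrite /delta; field; lra.
have -> : n%:R * delta / (8 * k) = 2 * (n%:R * delta / (16 * k)).
  by field; lra.
by lra.
Qed.
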